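(* Let $f(x,y)$ be a nonzero real polynomial in two variables that has a positive representation, i.e. $f(x,y) = f_2(x,y)/f_1(x,y)$ where $f_1\ne 0$ and $f_2$ are polynomials in $x$ and $y$ with nonnegative real coefficients. Then $$f(\infty, y) > 0 \text{ for all real } y>0 \quad\text{and}\quad f(x, \infty) > 0 \text{ for all real } x>0.$$
   Context: For a nonzero real polynomial $f(x,y)$ with highest power $x^{\lambda}$ of $x$ and highest power $y^{\nu}$ of $y$, $f(\infty,y)$ denotes the polynomial in $y$ that is the coefficient of $x^{\lambda}$ in $f$, i.e. $f(\infty,y)=\lim_{x\to\infty} f(x,y)/x^{\lambda}$, and $f(x,\infty)$ denotes the polynomial in $x$ that is the coefficient of $y^{\nu}$ in $f$, i.e. $f(x,\infty)=\lim_{y\to\infty} f(x,y)/y^{\nu}$. *)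

(* Defs.v *)
From mathcomp Require Import all_boot all_order all_algebra.
From mathcomp Require Import reals.

Set Implicit Arguments.
Unset Strict Implicit.
Unset Printing Implicit Defensive.

Import Order.TTheory GRing.Theory Num.Theory.
Local Open Scope ring_scope.

(* A bivariate polynomial f(x, y) is an element of {poly {poly R}}: the outer
   variable is x and the inner one is y, so that f`_i`_j is the coefficient of
   x^i y^j (as in mathcomp's polyXY, where f.[x, y] is evaluation). *)

Definition nonneg_coefs (R : realType) (f : {poly {poly R}}) : Prop :=
  forall i j : nat, 0 <= f`_i`_j.

(* The quotient f2 / f1 is taken in the field of rational functions R(x, y). *)
Definition positive_representation (R : realType) (f : {poly {poly R}}) : Prop :=
  exists f1 f2 : {poly {poly R}},
    [/\ f1 != 0, nonneg_coefs f1, nonneg_coefs f2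
      & FracField.tofrac f = FracField.tofrac f2 / FracField.tofrac f1].

(* f(oo, y), as a polynomial in y: the coefficient of the highest power of x. *)
Definition at_x_infty (R : realType) (f : {poly {poly R}}) : {poly R} :=
  lead_coef f.

(* f(x, oo), as a polynomial in x: the coefficient of the highest power of y.
   swapXY f views f as a polynomial in y with coefficients in R[x]. *)
Definition at_y_infty (R : realType) (f : {poly {poly R}}) : {poly R} :=
  lead_coef (swapXY f).

(* Main.v *)
(** From [f * f1 = f2] and multiplicativity of leading coefficients,
    [f(oo, y) * f1(oo, y) = f2(oo, y)]; the last two are nonzero polynomials
    with nonnegative coefficients, hence positive at every [y > 0]. The case of
    [f(x, oo)] follows by exchanging the variables. *)
Require Import Defs.
From mathcomp Require Import all_boot all_order all_algebra.
From mathcomp Require Import reals.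

Import Order.TTheory GRing.Theory Num.Theory.
Local Open Scope ring_scope.

(** At [x > 0] every term is nonnegative, and the top one is strictly positive because its
    coefficient is nonnegative and nonzero. *)
Lemma horner_gt0 (R : numDomainType) (p : {poly R}) (x : R) :
  p != 0 -> (forall i, 0 <= p`_i) -> 0 < x -> 0 < p.[x].
Proof.
move=> p_neq0 p_ge0 x_gt0; rewrite horner_coef.
case def_n: (size p) => [|n]; first by rewrite -size_poly_gt0 def_n in p_neq0.
rewrite big_ord_recr /=; apply: ltr_wpDl.
  by apply: sumr_ge0 => i _; rewrite mulr_ge0 // exprn_ge0 // ltW.
rewrite mulr_gt0 ?exprn_gt0 // lt0r p_ge0 andbT.
by move: p_neq0; rewrite -lead_coef_eq0 lead_coefE def_n.
Qed.

Lemma nonneg_coefs_swapXY (R : realType) (f : {poly {poly R}}) :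
  nonneg_coefs f -> nonneg_coefs (swapXY f).
Proof. by move=> f_ge0 i j; rewrite coef_swapXY. Qed.

Lemma lead_coef_gt0_of_mul (R : realType) (f f1 f2 : {poly {poly R}}) (y : R) :
    f != 0 -> f1 != 0 -> nonneg_coefs f1 -> nonneg_coefs f2 -> f * f1 = f2 ->
  0 < y -> 0 < (lead_coef f).[y].
Proof.
move=> f_neq0 f1_neq0 f1_ge0 f2_ge0 def_f2 y_gt0.
have lc_gt0 g : g != 0 -> nonneg_coefs g -> 0 < (lead_coef g).[y].
  move=> g_neq0 g_ge0.
  by apply: horner_gt0; rewrite ?lead_coef_eq0 // => i; apply: g_ge0.
have f2_neq0 : f2 != 0 by rewrite -def_f2 mulf_neq0.
have := lc_gt0 f2 f2_neq0 f2_ge0.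
(* Coefficients of [f] may be negative, so its sign is obtained by cancelling the positive factor
   [(lead_coef f1).[y]] from a positive product. *)
by rewrite -def_f2 lead_coefM hornerM pmulr_lgt0 //; apply: lc_gt0.
Qed.

(** Denominators can be cleared inside the polynomial ring because [tofrac] is an injective ring
    morphism. *)
Lemma positive_representationP (R : realType) (f : {poly {poly R}}) :
  positive_representation f ->
  exists f1 f2 : {poly {poly R}},
    [/\ f1 != 0, nonneg_coefs f1, nonneg_coefs f2 & f * f1 = f2].
Proof.
case=> f1 [f2 [f1_neq0 f1_ge0 f2_ge0 def_f]]; exists f1, f2; split=> //.
apply/eqP; rewrite -tofrac_eq tofracM def_f.
by rewrite divfK // tofrac_eq0.
Qed.

Theorem mainTheorem3 (R : realType) (f : {poly {poly R}})
    (f_neq0 : f != 0) (f_pos : positive_representation f) :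
  (forall y : R, 0 < y -> 0 < (at_x_infty f).[y]) /\
  (forall x : R, 0 < x -> 0 < (at_y_infty f).[x]).
Proof.
have [f1 [f2 [f1_neq0 f1_ge0 f2_ge0 def_f2]]] := positive_representationP _ _ f_pos.
split=> [y|x]; first exact: lead_coef_gt0_of_mul def_f2.
(* [swapXY] is an injective ring morphism that only permutes coefficients, so all hypotheses
   transfer. *)
apply: (@lead_coef_gt0_of_mul _ _ (swapXY f1) (swapXY f2)).
- by rewrite swapXY_eq0.
- by rewrite swapXY_eq0.
- exact: nonneg_coefs_swapXY.
- exact: nonneg_coefs_swapXY.
- by rewrite -def_f2 rmorphM.
Qed.
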